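(* Let $G$ be a finite simple $3$-connected graph with edge set $E$, cycle space $Z(G)$ and cut space $B(G)$. There is exactly one $\mathrm{Cyc}(G)$-invariant projection $P:\ell_2(E)\to Z(G)$ if and only if the natural representations of the automorphism group $\mathrm{Aut}(G)$ on $Z(G)$ and on $B(G)$ do not have equivalent restrictions to non-zero subspaces; that is, if and only if there do not exist non-zero $\mathrm{Aut}(G)$-invariant subspaces $U\subseteq Z(G)$ and $V\subseteq B(G)$ such that the real representations of $\mathrm{Aut}(G)$ on $U$ and on $V$ are equivalent.
   Context: Fix an arbitrary orientation of the edges of $G=(V,E)$; for an edge $e$ let $e^-$ be its tail and $e^+$ its head. The cycle space is $Z(G)=\{F\in\mathbb{R}^E:\ \sum_{e^+=v}F(e)=\sum_{e^-=v}F(e)\text{ for all }v\in V\}$, and the cut space $B(G)$ is its orthogonal complement in $\mathbb{R}^E$. $\ell_1(E)$ and $\ell_2(E)$ denote $\mathbb{R}^E$ with the $\ell_1$- and $\ell_2$-norms. $\mathrm{Cyc}(G)$ is the group of linear isometries of $\ell_1(E)$ that map $Z(G)$ onto itself. For an edge $uv$ write $\overrightarrow{uv}\in\mathbb{R}^E$ for its unit basis vector if its orientation is from $u$ to $v$, and $\overrightarrow{vu}=-\overrightarrow{uv}$. Each $\phi\in\mathrm{Aut}(G)$ acts on $\mathbb{R}^E$ by the linear map $\hat\phi(\overrightarrow{uv})=\overrightarrow{\phi(u)\phi(v)}$, which leaves $Z(G)$ and $B(G)$ invariant; this gives the natural representations of $\mathrm{Aut}(G)$ on $Z(G)$ and $B(G)$.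 A (linear) projection $P$ onto $Z(G)$ is $\mathrm{Cyc}(G)$-invariant if $PA=AP$ for every $A\in\mathrm{Cyc}(G)$. *)

(* Defs.v *)
From HB Require Import structures.
From mathcomp Require Import all_boot all_order all_algebra all_fingroup.
From mathcomp Require Import mxrepresentation.
From mathcomp Require Import reals.

Set Implicit Arguments.
Unset Strict Implicit.
Unset Printing Implicit Defensive.

Import Order.TTheory GRing.Theory Num.Theory.
Local Open Scope ring_scope.

Record sgraph (T : finType) := SGraph {
  adj :> rel T;
  adj_sym : symmetric adj;
  adj_irr : irreflexive adj
}.

(* Removing fewer than k vertices never disconnects G, and G has more than
   k vertices; in particular the complete graph on k+1 vertices is
   k-connected. *)
Definition kconnected (T : finType) (k : nat) (G : sgraph T) : Prop :=
  (k < #|T|)%N /\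
  forall S : {set T}, (#|S| < k)%N ->
    {in ~: S &, forall x y,
      connect [rel u v | [&& u \notin S, v \notin S & G u v]] x y}.

(* An orientation is the set of its arcs (tail, head): every edge occurs in
   exactly one direction, and nothing else occurs. *)
Record orientation (T : finType) (G : sgraph T) := Orientation {
  arcs :> {set T * T};
  arcs_adj : forall u v, G u v = ((u, v) \in arcs) || ((v, u) \in arcs);
  arcs_asym : forall u v, (u, v) \in arcs -> (v, u) \notin arcs
}.

Section Aut.
Variables (T : finType) (G : sgraph T).

Definition aut_set : {set {perm T}} :=
  [set p : {perm T} | [forall u, forall v, G (p u) (p v) == G u v]].

Lemma autP (p : {perm T}) :
  reflect (forall u v, G (p u) (p v) = G u v) (p \in aut_set).
Proof.
rewrite inE; apply: (iffP forallP) => [h u v|h u].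
  by have /forallP/(_ v)/eqP := h u.
by apply/forallP => v; rewrite h.
Qed.

Lemma aut_group_set : group_set aut_set.
Proof.
apply/group_setP; split; first by apply/autP => u v; rewrite !perm1.
by move=> p q /autP hp /autP hq; apply/autP => u v; rewrite !permM hq hp.
Qed.

Definition Aut : {group {perm T}} := Group aut_group_set.

End Aut.

(* R^E is 'rV[R]_#|D|, the coordinate i standing for the arc enum_val i.
   Linear maps are square matrices acting on row vectors from the right, and
   subspaces are row spaces. *)
Section EdgeSpace.
Variables (R : realType) (T : finType) (G : sgraph T) (D : orientation G).

Definition tail (i : 'I_#|D|) : T := (enum_val i).1.
Definition head (i : 'I_#|D|) : T := (enum_val i).2.

Definition incidence : 'M[R]_(#|D|, #|T|) :=
  \matrix_(i, j) ((head i == enum_val j)%:R - (tail i == enum_val j)%:R).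

Definition cycle_space : 'M[R]_#|D| := kermx incidence.

Lemma cycle_spaceP (F : 'rV[R]_#|D|) :
  reflect (forall v : T, \sum_(i | head i == v) F 0 i =
                         \sum_(i | tail i == v) F 0 i)
          (F <= cycle_space)%MS.
Proof.
have E j : (F *m incidence) 0 j = \sum_(i | head i == enum_val j) F 0 i -
                                  \sum_(i | tail i == enum_val j) F 0 i.
  rewrite mxE [X in X - _]big_mkcond [X in _ - X]big_mkcond -sumrB /=.
  apply: eq_bigr => i _; rewrite mxE mulrBr.
  by do 2![case: (_ == _)]; rewrite ?mulr1 ?mulr0.
apply: (iffP sub_kermxP) => [h v|h].
  apply/eqP; rewrite -subr_eq0 -(enum_rankK v).
  by rewrite -E h mxE.
by apply/rowP => j; rewrite E h subrr mxE.
Qed.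

Definition cut_space : 'M[R]_#|D| := kermx cycle_space^T.

Lemma cut_spaceP (F : 'rV[R]_#|D|) :
  reflect (forall H : 'rV[R]_#|D|, (H <= cycle_space)%MS ->
             \sum_i F 0 i * H 0 i = 0)
          (F <= cut_space)%MS.
Proof.
have E (H : 'rV[R]_#|D|) : \sum_i F 0 i * H 0 i = (F *m H^T) 0 0.
  by rewrite mxE; apply: eq_bigr => i _; rewrite mxE.
apply: (iffP sub_kermxP) => [h H /submxP[C ->]|h].
  by rewrite E trmx_mul mulmxA h mul0mx mxE.
apply/rowP => j; rewrite mxE [RHS]mxE -[RHS](h _ (row_sub j cycle_space)).
by apply: eq_bigr => i _; rewrite !mxE.
Qed.

(* For an edge uv this is the unit vector of uv oriented from u to v, that
   is, minus the basis vector when the orientation is from v to u. *)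
Definition arc_vec (u v : T) : 'rV[R]_#|D| :=
  \row_i ((enum_val i == (u, v))%:R - (enum_val i == (v, u))%:R).

Definition aut_mx (p : {perm T}) : 'M[R]_#|D| :=
  \matrix_i arc_vec (p (tail i)) (p (head i)).

Lemma arc_vecN u v : arc_vec v u = - arc_vec u v.
Proof. by apply/rowP => i; rewrite !mxE opprB. Qed.

Lemma arc_vec_arc i : arc_vec (tail i) (head i) = delta_mx 0 i.
Proof.
have Di : (tail i, head i) = enum_val i by rewrite /tail /head; case: enum_val.
apply/rowP => j; rewrite !mxE eqxx /= Di (inj_eq enum_val_inj).
suff /negbTE -> : enum_val j != (head i, tail i) by rewrite subr0.
apply: contraTneq (enum_valP j) => ->.
by apply: arcs_asym; rewrite Di enum_valP.
Qed.

Lemma arc_vec_aut (p : {perm T}) u v :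
  G u v -> arc_vec u v *m aut_mx p = arc_vec (p u) (p v).
Proof.
have arcE x y : (x, y) \in D -> arc_vec x y *m aut_mx p = arc_vec (p x) (p y).
  move=> Dxy; have [i Di] : exists i : 'I_#|D|, enum_val i = (x, y).
    by exists (enum_rank_in Dxy (x, y)); rewrite enum_rankK_in.
  have [-> ->] : x = tail i /\ y = head i by rewrite /tail /head Di.
  by rewrite arc_vec_arc -rowE rowK.
rewrite (arcs_adj D) => /orP[/arcE // | /arcE E].
by rewrite arc_vecN mulNmx E -arc_vecN.
Qed.

Lemma aut_mx_repr : mx_repr (Aut G) aut_mx.
Proof.
split=> [|p q /autP Ap _].
  by apply/row_matrixP => i; rewrite rowK !perm1 arc_vec_arc rowE mulmx1.
apply/row_matrixP => i; rewrite row_mul !rowK !permM arc_vec_aut //.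
by rewrite Ap (arcs_adj D) /tail /head -surjective_pairing enum_valP.
Qed.

(* Permutations compose from left to right, in accordance with the right
   action on row vectors. *)
Definition aut_repr : mx_representation R (Aut G) #|D| :=
  MxRepresentation aut_mx_repr.

Definition l1norm (F : 'rV[R]_#|D|) : R := \sum_i `|F 0 i|.

Definition Cyc (A : 'M[R]_#|D|) : Prop :=
  (forall F : 'rV[R]_#|D|, l1norm (F *m A) = l1norm F) /\
  (cycle_space *m A :=: cycle_space)%MS.

Definition projection_onto (W P : 'M[R]_#|D|) : Prop :=
  P *m P = P /\ (P :=: W)%MS.

Definition Cyc_invariant (P : 'M[R]_#|D|) : Prop :=
  forall A : 'M[R]_#|D|, Cyc A -> P *m A = A *m P.

End EdgeSpace.

(* Main.v *)
Require Import Defs.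
From HB Require Import structures.
From mathcomp Require Import all_boot all_order all_algebra all_fingroup.
From mathcomp Require Import mxrepresentation.
From mathcomp Require Import reals ring lra.

Set Implicit Arguments.
Unset Strict Implicit.
Unset Printing Implicit Defensive.

Import Order.TTheory GRing.Theory Num.Theory.
Local Open Scope ring_scope.

(* An l1-isometry is a signed permutation matrix [A]. If it preserves the cycle
   space of a 3-connected graph, then it also preserves the cut space, whose
   elements are the differences of potentials. For a vertex [v], the graph
   [G - v] is 2-connected, so that its cycle space is indecomposable, and the
   star of [v] has minimal support among cuts; both properties pass to the
   image of the star, and they force this image to be a multiple of the star of
   another vertex. Hence [A] is, up to a global sign, induced by an automorphism
   (a signed form of Whitney's theorem), and being Cyc-invariant amounts to
   being Aut-invariant. Two Aut-invariant projections onto the cycle space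
   differ by an equivariant map from the cut space to the cycle space. *)

(** * Orthogonal complements and equivariant projections *)

Section Orthogonal.
Variable R : realFieldType.

(** [cut_space] unfolds to [orthmx] of [cycle_space], so this section applies to it by
    conversion. *)
Definition orthmx m n (W : 'M[R]_(m, n)) : 'M[R]_n := kermx W^T.

Lemma row_mul_tr_eq0 n (u : 'rV[R]_n) : u *m u^T = 0 -> u = 0.
Proof.
move=> /matrixP/(_ 0 0); rewrite !mxE => s0; apply/rowP => i; rewrite mxE.
have sq_ge0 j : true -> 0 <= u 0 j * u^T j 0 by rewrite mxE -expr2 sqr_ge0.
have := psumr_eq0P sq_ge0 s0 (i := i) isT.
by rewrite mxE => /eqP; rewrite -expr2 sqrf_eq0 => /eqP.
Qed.

Lemma cap_orthmx m n (W : 'M[R]_(m, n)) : (W :&: orthmx W)%MS = 0.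
Proof.
apply/eqP/rowV0P => u; rewrite sub_capmx => /andP[/submxP[a ->] /sub_kermxP a0].
by apply: row_mul_tr_eq0; rewrite trmx_mul mulmxA a0 mul0mx.
Qed.

Lemma add_orthmx m n (W : 'M[R]_(m, n)) : (W + orthmx W :=: 1%:M)%MS.
Proof.
apply/eqmxP; rewrite submx1 sub1mx /row_full.
have := mxrank_sum_cap W (orthmx W); rewrite cap_orthmx mxrank0 addn0 => ->.
by rewrite mxrank_ker mxrank_tr subnKC ?rank_leq_col ?eqxx.
Qed.

Lemma orthmxK m n (W : 'M[R]_(m, n)) : (orthmx (orthmx W) :=: W)%MS.
Proof.
apply/eqmxP; rewrite andbC -(geq_leqif (mxrank_leqif_eq _)).
  by rewrite !(mxrank_ker, mxrank_tr) subKn ?rank_leq_col.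
by rewrite sub_kermx -[W in W *m _]trmxK -trmx_mul mulmx_ker trmx0.
Qed.

Lemma orthmxS m1 m2 n (W1 : 'M[R]_(m1, n)) (W2 : 'M[R]_(m2, n)) :
  (W1 <= W2)%MS -> (orthmx W2 <= orthmx W1)%MS.
Proof.
by case/submxP=> C ->; rewrite sub_kermx trmx_mul mulmxA mulmx_ker mul0mx.
Qed.

Lemma orthmx_stable m n (W : 'M[R]_(m, n)) (A : 'M[R]_n) :
  (W *m A^T <= W)%MS -> (orthmx W *m A <= orthmx W)%MS.
Proof.
case/submxP=> C WA; rewrite sub_kermx -mulmxA -[A]trmxK -trmx_mul WA.
by rewrite trmx_mul mulmxA mulmx_ker mul0mx.
Qed.

Definition orthproj n (W : 'M[R]_n) : 'M[R]_n := proj_mx W (orthmx W).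

Lemma orthproj_sub m n (W : 'M[R]_n) (X : 'M[R]_(m, n)) :
  (X *m orthproj W <= W)%MS.
Proof. exact: proj_mx_sub. Qed.

Lemma orthproj_id m n (W : 'M[R]_n) (X : 'M[R]_(m, n)) :
  (X <= W)%MS -> X *m orthproj W = X.
Proof. exact/proj_mx_id/cap_orthmx. Qed.

Lemma orthproj0 m n (W : 'M[R]_n) (X : 'M[R]_(m, n)) :
  (X <= orthmx W)%MS -> X *m orthproj W = 0.
Proof. exact/proj_mx_0/cap_orthmx. Qed.

Lemma orthproj_compl m n (W : 'M[R]_n) (X : 'M[R]_(m, n)) :
  (X - X *m orthproj W <= orthmx W)%MS.
Proof. by rewrite proj_mx_compl_sub // add_orthmx submx1. Qed.

(** The condition on the transpose makes [orthmx W] stable under [A] too, so [A] respects both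
    summands of the decomposition. *)
Lemma orthproj_comm n (W A : 'M[R]_n) :
  (W *m A <= W)%MS -> (W *m A^T <= W)%MS ->
  orthproj W *m A = A *m orthproj W.
Proof.
move=> WA WAT; set Q := orthproj W.
have QW : (Q <= W)%MS by rewrite -[Q]mul1mx orthproj_sub.
have QA : Q *m A *m Q = Q *m A.
  by rewrite orthproj_id // (submx_trans _ WA) ?submxMr.
have CA : (1%:M - Q) *m A *m Q = 0.
  apply: orthproj0; apply: submx_trans (orthmx_stable WAT).
  by rewrite submxMr // -[Q]mul1mx orthproj_compl.
apply/eqP; rewrite eq_sym -subr_eq0 -QA -mulmxBl.
by move: CA; rewrite [(1%:M - Q) *m A]mulmxBl mul1mx => ->.
Qed.

End Orthogonal.

Lemma mxmodule_orthmx (R : realFieldType) (gT : finGroupType) (G : {group gT})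
    n (rG : mx_representation R G n) m (W : 'M[R]_(m, n)) :
  (forall x, x \in G -> (rG x)^T = rG x^-1%g) ->
  mxmodule rG W -> mxmodule rG (orthmx W).
Proof.
move=> rGT /mxmoduleP modW; apply/mxmoduleP => x Gx.
by apply: orthmx_stable; rewrite rGT // modW ?groupV.
Qed.

(* A second equivariant projection differs from the orthogonal one by an
   equivariant map killing [Z]; on the orthogonal of its kernel this map is an
   isomorphism onto its image. Conversely, an isomorphism from a submodule of
   the orthogonal of [Z] to a submodule of [Z] is such a map after composition
   with an orthogonal projection. *)
Lemma unique_equivariant_projection (R : realFieldType) (gT : finGroupType)
    (G : {group gT}) n (rG : mx_representation R G n) (Z : 'M[R]_n) :
  (forall x, x \in G -> (rG x)^T = rG x^-1%g) -> mxmodule rG Z ->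
  (exists! P : 'M[R]_n, (P *m P = P /\ (P :=: Z)%MS) /\ centgmx rG P)
  <->
  ~ (exists (U V : 'M[R]_n) (modU : mxmodule rG U) (modV : mxmodule rG V),
       [/\ U != 0, V != 0, (U <= Z)%MS, (V <= orthmx Z)%MS
         & mx_rsim (submod_repr modU) (submod_repr modV)]).
Proof.
move=> rGT modZ; set Q := orthproj Z.
have cQ W : mxmodule rG W -> centgmx rG (orthproj W).
  move=> modW; apply/centgmxP => x Gx.
  apply: orthproj_comm; first exact: (mxmoduleP modW).
  by rewrite rGT // (mxmoduleP modW) ?groupV.
have projP P : (P <= Z)%MS -> Z *m P = Z -> P *m P = P /\ (P :=: Z)%MS.
  move=> PZ ZP; split.
    by case/submxP: PZ => C E; rewrite {1}E -mulmxA ZP -E.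
  by apply/eqmxP; rewrite PZ -{1}ZP submxMl.
have QZ : (Q <= Z)%MS by rewrite -[Q]mul1mx orthproj_sub.
have ZQ : Z *m Q = Z by rewrite orthproj_id.
split=> [[P0 [_ uniqP]] [U [V [modU [modV [U0 V0 UZ VB simUV]]]]] | noUV].
  have [f _ homf Vf] := (mx_rsim_iso modV modU).1 (mx_rsim_sym simUV).
  (* [N] kills [Z] and takes values in [Z], so [Q + N] is a second equivariant projection onto [Z].
     Uniqueness gives [N = 0], whereas [N] maps [V] onto [U]. *)
  set N := orthproj V *m f.
  have VV : (orthproj V <= V)%MS by rewrite -[orthproj V]mul1mx orthproj_sub.
  have NU : (N <= U)%MS by rewrite -Vf submxMr.
  have ZN : Z *m N = 0.
    rewrite mulmxA orthproj0 ?mul0mx //.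
    by apply: submx_trans (orthmxS VB); rewrite orthmxK.
  have PQ : P0 = Q by apply: uniqP; split; [apply: projP | apply: cQ].
  have PN : P0 = Q + N.
    apply: uniqP; split.
      apply: projP; last by rewrite mulmxDr ZN addr0.
      by rewrite addmx_sub // (submx_trans NU).
    apply/centgmxP => x Gx; rewrite mulmxDl mulmxDr (centgmxP (cQ _ modZ)) //.
    congr (_ + _); rewrite /N [RHS]mulmxA -(centgmxP (cQ _ modV)) //.
    by rewrite (hom_mxP (submx_trans VV homf)).
  case/negP: U0; rewrite -submx0 -Vf -[V](@orthproj_id _ _ _ V) // -mulmxA -/N.
  by move: PN; rewrite PQ -[X in X = _]addr0 => /addrI <-; rewrite mulmx0.
exists Q; split; first by split; [apply: projP | apply: cQ].
move=> P [[PP PZ] cP]; apply/eqP; rewrite -subr_eq0; apply/idPn => N0.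
set N := Q - P in N0.
have NZ : (N <= Z)%MS by rewrite addmx_sub // eqmx_opp PZ.
have ZN : Z *m N = 0.
  rewrite mulmxBr ZQ; suff -> : Z *m P = Z by rewrite subrr.
  by have /submxP[C ->] : (Z <= P)%MS; [rewrite PZ | rewrite -mulmxA PP].
have cN : centgmx rG N.
  apply/centgmxP => x Gx; rewrite mulmxBl mulmxBr.
  by rewrite (centgmxP (cQ _ modZ)) // (centgmxP cP).
set V := orthmx (kermx N).
have modV : mxmodule rG V.
  by apply: mxmodule_orthmx => //; apply: kermx_centg_module.
have homV : (V <= dom_hom_mx rG N)%MS by apply: centgmx_hom.
have modU : mxmodule rG (V *m N) by apply: hom_mxmodule.
have rVN : \rank (V *m N) = \rank V.
  apply/mxrank_injP; rewrite -submx0 -(cap_orthmx (kermx N)) sub_capmx.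
  by rewrite capmxSr capmxSl.
have NV : (N <= V *m N)%MS.
  rewrite -[N in (N <= _)%MS]mul1mx -(eqmxMr N (add_orthmx (kermx N))).
  by rewrite addsmxMr mulmx_ker addsmx_sub sub0mx /=.
have U0 : V *m N != 0 by apply: contra N0 => /eqP VN0; rewrite -submx0 -VN0.
apply: noUV; exists (V *m N), V, modU, modV; split=> //.
- by apply: contra U0 => /eqP ->; rewrite mul0mx.
- by rewrite (submx_trans (submxMl _ _)).
- by apply: orthmxS; apply/sub_kermxP.
(* An isomorphism of submodules is given here by a matrix invertible on the whole space; [g] is one
   that agrees with [N] on [V], where [N] is injective. *)
apply/mx_rsim_sym/mx_rsim_iso; have [g injg VNg] := complete_unitmx rVN.
exists g; [exact: injg | | by rewrite VNg].
apply/hom_mxP => x Gx; rewrite -VNg -(hom_mxP homV) //.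
by have [C ->] := submxP (mxmoduleP modV x Gx); rewrite -!(mulmxA C) VNg.
Qed.

(** * Isometries of l1 *)

(** Every row has norm 1, and the sum and the difference of two rows both have norm 2. Hence two
    rows cancel nowhere, with either sign, so their supports are disjoint; [n] disjoint nonempty
    supports among [n] columns are single entries. *)
Lemma l1_isometry_monomial (R : realFieldType) n (A : 'M[R]_n) :
  (forall F : 'rV[R]_n, \sum_k `|(F *m A) 0 k| = \sum_k `|F 0 k|) ->
  exists (sigma : 'S_n) (s : 'I_n -> R),
    (forall i k, A i k = s i *+ (k == sigma i)) /\ (forall i, `|s i| = 1).
Proof.
move=> isoA.
have sum_eq (i : 'I_n) : \sum_k ((k == i)%:R : R) = 1.
  rewrite (bigD1 i) //= eqxx big1 ?addr0 // => k /negbTE ->; exact: erefl.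
have norm_row i : \sum_k `|A i k| = 1.
  rewrite -(sum_eq i); have := isoA (delta_mx 0 i); rewrite -rowE => e.
  rewrite (eq_bigr (fun k => `|row i A 0 k|)) => [|k _]; last by rewrite mxE.
  by rewrite e; apply: eq_bigr => k _; rewrite mxE eqxx /= normr_nat.
have norm_rows i j (c : R) : i != j -> `|c| = 1 ->
    forall k, `|A i k + c * A j k| = `|A i k| + `|A j k|.
  move=> ij c1 k.
  have ge0 l : true -> 0 <= `|A i l| + `|A j l| - `|A i l + c * A j l|.
    by rewrite subr_ge0 (le_trans (ler_normD _ _)) // normrM c1 mul1r.
  have sum2 : \sum_l `|A i l + c * A j l| = 1 + 1.
    have := isoA (delta_mx 0 i + c *: delta_mx 0 j).
    rewrite mulmxDl -scalemxAl -!rowE => e.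
    rewrite (eq_bigr (fun l => `|(row i A + c *: row j A) 0 l|)); last first.
      by move=> l _; rewrite !mxE.
    rewrite e.
    transitivity (\sum_l ((l == i)%:R + (l == j)%:R) : R); last first.
      by rewrite big_split /= !sum_eq.
    apply: eq_bigr => l _; rewrite !mxE eqxx /=.
    have [->|li] := eqVneq l i.
      by rewrite (negbTE ij) mulr1n mulr0n mulr0 !addr0 normr1.
    by rewrite mulr0n !add0r normrM c1 mul1r normr_nat.
  have sum0 : \sum_l (`|A i l| + `|A j l| - `|A i l + c * A j l|) = 0.
    by rewrite sumrB big_split /= !norm_row sum2 subrr.
  have /eqP := psumr_eq0P ge0 sum0 (i := k) isT.
  by rewrite subr_eq0 => /eqP ->.
have disj i j k : i != j -> A i k * A j k = 0.
  move=> ij; have := norm_rows i j 1 ij (normr1 _) k.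
  rewrite -(norm_rows i j (-1) ij) ?normrN1 // mul1r mulN1r => e.
  have sq x y : `|x| = `|y| -> x ^+ 2 = y ^+ 2 :> R.
    move=> xy; rewrite -[x ^+ 2]real_normK ?num_real // xy.
    by rewrite real_normK ?num_real.
  by have := sq _ _ e; lra.
have nz i : exists k, A i k != 0.
  apply/existsP; apply: contraT; rewrite negb_exists => /forallP A0.
  have := norm_row i.
  rewrite big1 => [/esym/eqP|k _]; first by rewrite oner_eq0.
  by move: (A0 k); rewrite negbK => /eqP ->; rewrite normr0.
pose f i := xchoose (nz i).
have fP i : A i (f i) != 0 := xchooseP (nz i).
have injf : injective f.
  move=> i j fij; apply/eqP; apply: contraT => /(disj i j (f i))/eqP.
  by rewrite mulf_eq0 {2}fij !(negbTE (fP _)).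
(* Injectivity makes [f] a bijection, so a column [k] other than [f i] is [f j] for another row [j],
   and disjointness clears [A i k]. *)
have AE i k : A i k = A i (f i) *+ (k == perm injf i).
  rewrite permE; have [-> //|kfi] := eqVneq k (f i).
  have kE : k = f ((perm injf)^-1%g k) by rewrite -(permE injf) permKV.
  set j := (perm injf)^-1%g k in kE.
  have ij : i != j by apply: contraNneq kfi => ->; rewrite -kE.
  have /eqP := disj i j k ij.
  by rewrite mulf_eq0 {2}kE (negbTE (fP j)) orbF => /eqP.
exists (perm injf), (fun i => A i (f i)); split=> // i.
rewrite -[RHS](norm_row i) (bigD1 (f i)) //= big1 ?addr0 // => k kfi.
by rewrite AE permE (negbTE kfi) normr0.
Qed.

(** * Cuts, cycles and vertex stars *)

(* [seq.head] and [automorphism.Aut] shadow the graph notions. *)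
Local Notation head := Defs.head.
Local Notation Aut := Defs.Aut.

Section Potentials.
Variables (R : realType) (T : finType) (G : sgraph T) (D : orientation G).
Implicit Types (F H : 'rV[R]_#|D|) (g h : T -> R) (u v w x y : T).
Implicit Types (i j k : 'I_#|D|).

Definition dotv F H : R := \sum_i F 0 i * H 0 i.

Definition pot g : 'rV[R]_#|D| := \row_i (g (head i) - g (tail i)).

Definition star v : 'rV[R]_#|D| := pot (fun u => (u == v)%:R).

Lemma dotvE F H : dotv F H = (F *m H^T) 0 0.
Proof. by rewrite mxE; apply: eq_bigr => i _; rewrite mxE. Qed.

Lemma dotvDl F1 F2 H : dotv (F1 + F2) H = dotv F1 H + dotv F2 H.
Proof. by rewrite !dotvE mulmxDl mxE. Qed.

Lemma dotvZl (a : R) F H : dotv (a *: F) H = a * dotv F H.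
Proof. by rewrite !dotvE -scalemxAl mxE. Qed.

Lemma dotv_delta i H : dotv (delta_mx 0 i) H = H 0 i.
Proof. by rewrite dotvE -rowE !mxE. Qed.

Lemma pot_incidence g : pot g = (\row_j g (enum_val j)) *m (incidence R D)^T.
Proof.
apply/rowP => i; rewrite !mxE.
have E v : \sum_(j < #|T|) g (enum_val j) * (v == enum_val j)%:R = g v.
  rewrite (bigD1 (enum_rank v)) //= big1 ?addr0 ?enum_rankK ?eqxx ?mulr1 //.
  move=> j jv; rewrite (_ : v == _ = false) ?mulr0 //.
  by apply: contraNF jv => /eqP ->; rewrite enum_valK.
rewrite -{1}(E (head i)) -{1}(E (tail i)) -sumrB.
by apply: eq_bigr => j _; rewrite -mulrBr !mxE.
Qed.

Lemma cycle_potP F :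
  (F <= cycle_space R D)%MS <-> forall g, dotv F (pot g) = 0.
Proof.
split=> [/sub_kermxP F0 g | F0].
  by rewrite dotvE pot_incidence trmx_mul trmxK mulmxA F0 mul0mx mxE.
apply/sub_kermxP/rowP => j.
rewrite !mxE -[RHS](F0 (fun u => (u == enum_val j)%:R)).
by apply: eq_bigr => i _; rewrite !mxE.
Qed.

(** The cycle space is the orthogonal complement of the row space of the transposed incidence
    matrix; a second complement returns that row space, which consists of the potential
    differences. *)
Lemma cut_potP F : (F <= cut_space R D)%MS <-> exists g, F = pot g.
Proof.
have cutE : (cut_space R D :=: (incidence R D)^T)%MS.
  by have := orthmxK (incidence R D)^T; rewrite /orthmx trmxK.
rewrite cutE; split=> [/submxP[a ->] | [g ->]]; last first.
  by rewrite pot_incidence submxMl.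
exists (fun u => a 0 (enum_rank u)); rewrite pot_incidence; congr (_ *m _).
by apply/rowP => j; rewrite mxE enum_valK.
Qed.

Lemma arc_adj i : G (tail i) (head i).
Proof. by rewrite (arcs_adj D) -surjective_pairing enum_valP. Qed.

Lemma head_neq_tail i : head i != tail i.
Proof. by apply: contraTneq (arc_adj i) => ->; rewrite adj_irr. Qed.

Lemma adj_arc u v : G u v ->
  exists i, (tail i = u /\ head i = v) \/ (tail i = v /\ head i = u).
Proof.
have ex x y : (x, y) \in D -> exists i, tail i = x /\ head i = y.
  move=> xy; exists (enum_rank_in xy (x, y)).
  by rewrite /tail /head enum_rankK_in.
by rewrite (arcs_adj D) => /orP[/ex[i e]|/ex[i e]]; exists i; [left|right].
Qed.

Lemma arc_vec_delta u v : G u v ->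
  exists i, (arc_vec R D u v = delta_mx 0 i \/ arc_vec R D u v = - delta_mx 0 i)
    /\ forall g, dotv (arc_vec R D u v) (pot g) = g v - g u.
Proof.
case/adj_arc=> i [] [<- <-]; exists i.
  by rewrite arc_vec_arc; split=> [|g]; [left | rewrite dotv_delta mxE].
rewrite arc_vecN arc_vec_arc; split=> [|g]; first by right.
by rewrite -scaleN1r dotvZl dotv_delta mxE mulN1r opprB.
Qed.

Lemma starE v i : star v 0 i = (head i == v)%:R - (tail i == v)%:R.
Proof. by rewrite mxE. Qed.

Lemma star_neq0 v i : (star v 0 i != 0) = (head i == v) || (tail i == v).
Proof.
rewrite starE; have := head_neq_tail i.
have [->|_] := eqVneq (head i) v; last first.
  by case: (tail i == v); rewrite ?subrr ?eqxx // sub0r oppr_eq0 oner_eq0.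
by rewrite eq_sym => /negbTE ->; rewrite subr0 oner_eq0.
Qed.

Lemma norm_star v i : star v 0 i != 0 -> `|star v 0 i| = 1.
Proof.
rewrite star_neq0 starE; have := head_neq_tail i.
have [->|_ _] := eqVneq (head i) v; last by move=> /= ->; rewrite sub0r normrN1.
by rewrite eq_sym => /negbTE ->; rewrite subr0 normr1.
Qed.

Lemma star2_ends u v i : u != v -> star u 0 i != 0 -> star v 0 i != 0 ->
  (head i = u /\ tail i = v) \/ (head i = v /\ tail i = u).
Proof.
rewrite !star_neq0 => uv /orP[]/eqP eu /orP[]/eqP ev; [|by left|by right|].
  by rewrite -eu -ev eqxx in uv.
by rewrite -eu -ev eqxx in uv.
Qed.

(** Serves to recognise automorphisms: a vertex permutation that matches the supports of stars
    preserves adjacency. *)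
Lemma adj_star u v :
  u != v -> G u v = [exists i, (star u 0 i != 0) && (star v 0 i != 0)].
Proof.
move=> uv; apply/idP/existsP => [/adj_arc[i ends] | [i /andP[ui vi]]].
  by exists i; rewrite !star_neq0; case: ends => -[-> ->]; rewrite !eqxx ?orbT.
have [[<- <-]|[<- <-]] := star2_ends uv ui vi; last by rewrite arc_adj.
by rewrite adj_sym arc_adj.
Qed.

(** The sign [star w 0 i] directs the edge [i] towards [w], and [x] is its other end. *)
Lemma star_other_end w i : star w 0 i != 0 -> exists x,
  [/\ x != w, G w x, star x 0 i != 0
    & forall g, star w 0 i * pot g 0 i = g w - g x].
Proof.
rewrite star_neq0 => wi; have ht := head_neq_tail i; have tG := arc_adj i.
case/orP: wi => /eqP <-.
  exists (tail i); split; rewrite ?star_neq0 ?eqxx ?orbT //.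
  - by rewrite eq_sym.
  - by rewrite adj_sym.
  by move=> g; rewrite starE mxE eqxx eq_sym (negbTE ht) subr0 mul1r.
exists (head i); split; rewrite ?star_neq0 ?eqxx // => g.
by rewrite starE mxE eqxx (negbTE ht) sub0r mulN1r opprB.
Qed.

Lemma pot_sum g : pot g = \sum_v g v *: star v.
Proof.
apply/rowP => i; rewrite summxE mxE.
have E x : \sum_v g v * (x == v)%:R = g x.
  rewrite (bigD1 x) //= eqxx mulr1 big1 ?addr0 // => v.
  by rewrite eq_sym => /negbTE ->; rewrite mulr0.
rewrite -{1}(E (head i)) -{1}(E (tail i)) -sumrB.
by apply: eq_bigr => v _; rewrite [in RHS]mxE starE mulrBr.
Qed.

Definition adj_off (S : {set T}) : rel T :=
  [rel u v | [&& u \notin S, v \notin S & G u v]].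

(** [F] is the unit flow along a path from [x] to [y], the sum of its arc vectors; no edge of the
    path meets [S]. *)
Lemma connect_flow (S : {set T}) x y : connect (adj_off S) x y ->
  exists F, (forall g, dotv F (pot g) = g y - g x) /\
            (forall i v, v \in S -> star v 0 i != 0 -> F 0 i = 0).
Proof.
case/connectP=> p; elim: p x => [|z p IH] x /=.
  move=> _ ->; exists 0; split=> [g|i v _ _]; last by rewrite mxE.
  by rewrite dotvE mul0mx mxE subrr.
case/andP=> /and3P[xS zS xz] /IH{}IH /IH[F [dF F0]].
have [_ [_ dxz]] := arc_vec_delta xz.
exists (arc_vec R D x z + F); split=> [g|i v vS vi].
  by rewrite dotvDl dxz dF; ring.
rewrite 2!mxE (F0 _ _ vS vi) addr0.
have ne a b : a \notin S -> b \notin S -> enum_val i != (a, b).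
  move=> aS bS; apply: contraTneq vi => e; rewrite star_neq0 /head /tail e /=.
  by rewrite negb_or (contraNneq _ bS) ?(contraNneq _ aS) // => ->.
by rewrite !(negbTE (ne _ _ _ _)) // subrr.
Qed.

Lemma connect_const (S : {set T}) (A : Type) (f : T -> A) x y :
  connect (adj_off S) x y ->
  (forall u v, adj_off S u v -> f u = f v) -> f x = f y.
Proof.
case/connectP=> p; elim: p x => [|z p IH] x /=; first by move=> _ ->.
by case/andP=> xz pz ey fS; rewrite (fS _ _ xz) (IH z).
Qed.

Lemma connect_neighbor (S : {set T}) x y :
  connect (adj_off S) x y -> x != y -> exists2 z, z \notin S & G x z.
Proof.
case/connectP=> [[|z p]] /=; first by move=> _ ->; rewrite eqxx.
by case/andP=> /and3P[_ zS xz] _ _ _; exists z.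
Qed.

(** * Consequences of 3-connectedness *)

Section Connected.
Hypothesis G3 : kconnected 3 G.

Lemma exists_notin (S : {set T}) : (#|S| < 4)%N -> exists x, x \notin S.
Proof.
move=> S4; have /set0Pn[x] : ~: S != set0.
  by rewrite -card_gt0 cardsCs setCK subn_gt0 (leq_trans S4) //; case: G3.
by rewrite inE; exists x.
Qed.

Lemma connect_off (S : {set T}) x y :
  (#|S| < 3)%N -> x \notin S -> y \notin S -> connect (adj_off S) x y.
Proof. by move=> S3 xS yS; apply: (G3.2 S S3); rewrite inE. Qed.

Lemma exists_neighbor v w : v != w -> exists2 z, z != w & G v z.
Proof.
move=> vw; have [y] : exists y, y \notin [set v; w].
  by apply: exists_notin; rewrite cards2; case: (v != w).
rewrite !inE negb_or => /andP[yv yw].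
have := @connect_off [set w] v y; rewrite cards1 !inE => /(_ isT vw yw).
case/connect_neighbor=> [|z]; first by rewrite eq_sym.
by rewrite inE; exists z.
Qed.

Lemma exists_star v : exists i, star v 0 i != 0.
Proof.
have [w] : exists w, w \notin [set v] by apply: exists_notin; rewrite cards1.
rewrite inE eq_sym => /exists_neighbor[z _ vz].
have vz' : v != z by apply: contraTneq vz => ->; rewrite adj_irr.
by move: vz; rewrite (adj_star vz') => /existsP[i /andP[]]; exists i.
Qed.

Lemma star_indep (a b : R) v w : v != w -> a *: star v = b *: star w -> a = 0.
Proof.
move=> vw /rowP e; have [z zw vz] := exists_neighbor vw.
have vz' : v != z by apply: contraTneq vz => ->; rewrite adj_irr.
move: vz; rewrite (adj_star vz') => /existsP[i /andP[vi zi]].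
have /eqP wi : star w 0 i == 0.
  apply: contraT => wi; move: zw vw; have := star2_ends vz' vi zi.
  by move: wi; rewrite star_neq0 => /orP[]/eqP <- [] [<- <-]; rewrite eqxx.
have := e i; rewrite [LHS]mxE [RHS]mxE wi mulr0 => /eqP.
by rewrite mulf_eq0 (negbTE vi) orbF => /eqP.
Qed.

(** [G - v] is connected, so a potential constant along its edges takes a single value off [v]. This
    is the minimality of the support of a star among cuts. *)
Lemma pot_supp_star v g :
  (forall i, star v 0 i = 0 -> pot g 0 i = 0) ->
  exists c : R, pot g = c *: star v.
Proof.
move=> gv; have [y yv] : exists y, y \notin [set v].
  by apply: exists_notin; rewrite cards1.
have gy u : u != v -> g u = g y.
  move=> uv; apply: (@connect_const [set v]).
    by apply: connect_off; rewrite ?cards1 // inE.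
  move=> a b /and3P[]; rewrite !inE => av bv /adj_arc[i ends].
  have /eqP : pot g 0 i = 0.
    apply: gv; apply/eqP; rewrite -[_ == _]negbK star_neq0 negb_or.
    by case: ends => -[-> ->]; rewrite av bv.
  by rewrite mxE subr_eq0; case: ends => -[-> ->] /eqP.
exists (g v - g y); apply/rowP => i; rewrite [RHS]mxE starE mxE.
have := head_neq_tail i.
have [->|hv] := eqVneq (head i) v; have [->|tv] := eqVneq (tail i) v.
- by [].
- by rewrite (gy _ tv) mulr1n mulr0n subr0 mulr1.
- by rewrite (gy _ hv) mulr1n mulr0n sub0r mulrN1 opprB.
- by rewrite (gy _ hv) (gy _ tv) !subrr mulr0.
Qed.

Lemma pot_const c : pot (fun=> c) = 0.
Proof. by apply/rowP => i; rewrite !mxE subrr. Qed.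

Lemma pot_eq0 g u v : pot g = 0 -> g u = g v.
Proof.
move=> /rowP g0; apply: (@connect_const set0).
  by apply: connect_off; rewrite ?cards0 ?inE.
move=> a b /and3P[_ _] /adj_arc[i ends]; have /eqP := g0 i.
by rewrite !mxE subr_eq0; case: ends => -[-> ->] /eqP.
Qed.

Definition restr (S : {set 'I_#|D|}) F : 'rV[R]_#|D| :=
  \row_i (F 0 i *+ (i \in S)).

(* Two edges at [w] avoiding [v] lie on a cycle of [G - v]: join their other
   ends in [G - v - w]. If only one of them were in [S], the restriction of
   this cycle to [S] would violate conservation at [w]. *)
Lemma star_compl_connected v (S : {set 'I_#|D|}) :
  (forall F, (F <= cycle_space R D)%MS ->
     (forall i, star v 0 i != 0 -> F 0 i = 0) ->
     (restr S F <= cycle_space R D)%MS) ->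
  forall i j, star v 0 i = 0 -> star v 0 j = 0 -> i \in S -> j \in S.
Proof.
move=> closedS.
have at_w w i j : w != v -> star w 0 i != 0 -> star w 0 j != 0 ->
    star v 0 i = 0 -> star v 0 j = 0 -> i \in S -> j \in S.
  move=> wv wi wj vi vj iS; apply: contraT => jS.
  have [x [xw _ xi dx]] := star_other_end wi.
  have [y [yw _ yj dy]] := star_other_end wj.
  have xv : x != v by apply: contraNneq xi => ->; rewrite vi.
  have yv : y != v by apply: contraNneq yj => ->; rewrite vj.
  have xy : connect (adj_off [set v; w]) x y.
    apply: connect_off; rewrite ?cards2 ?ltnS ?leq_b1 // !inE negb_or.
      by rewrite xv xw.
    by rewrite yv yw.
  have [F [dF F0]] := connect_flow xy.
  (* The closed walk from [w] along [i] to [x], through [F] to [y], and back to [w] along [j]. *)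
  pose C := (- star w 0 i) *: delta_mx 0 i + F + star w 0 j *: delta_mx 0 j.
  have Cz : (C <= cycle_space R D)%MS.
    apply/cycle_potP => g; rewrite !dotvDl !dotvZl !dotv_delta mulNr dx dy dF.
    by ring.
  have CE k : k != i -> k != j -> C 0 k = F 0 k.
    move=> ki kj; rewrite !mxE eqxx (negbTE ki) (negbTE kj) /=.
    by rewrite !mulr0 add0r addr0.
  have Cv k : star v 0 k != 0 -> C 0 k = 0.
    move=> vk; rewrite CE; first by rewrite (F0 k v) // !inE eqxx.
      by apply: contraNneq vk => ->; rewrite vi.
    by apply: contraNneq vk => ->; rewrite vj.
  (* Pairing the restriction of [C] with [star w] leaves only the edge [i], since [F] vanishes at
     [w] and [j] is outside [S]. Its term is minus the square of a nonzero entry. *)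
  have /eqP := (cycle_potP _).1 (closedS C Cz Cv) (fun u => (u == w)%:R).
  rewrite -/(star w) /dotv (bigD1 i) //= big1 => [|k ki].
    have ij : i != j by apply: contraNneq jS => <-.
    have Fi : F 0 i = 0 by apply: (F0 i w) => //; rewrite !inE eqxx orbT.
    rewrite addr0 mxE iS mulr1n !mxE Fi !eqxx (negbTE ij) /= mulr0 mulr1 !addr0.
    by rewrite -/(star w) mulf_eq0 oppr_eq0 -starE orbb (negbTE wi).
  rewrite mxE; case: (boolP (k \in S)) => kS; last by rewrite mul0r.
  have kj : k != j by apply: contraNneq jS => <-.
  rewrite mulr1n CE //.
  have [->|wk] := eqVneq (star w 0 k) 0; first exact: mulr0.
  by rewrite (F0 k w) ?mul0r // !inE eqxx orbT.
move=> i j vi vj iS.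
(* For [u] other than [v], a single edge of [u] in [S] and off the star of [v] already gives
   [inS u], by [at_w]; the property then spreads over the connected graph [G - v]. *)
pose inS u := [forall k, (star u 0 k != 0) ==> (star v 0 k == 0) ==> (k \in S)].
have inSP u k : u != v -> star u 0 k != 0 -> star v 0 k = 0 -> k \in S -> inS u.
  move=> uv uk vk kS; apply/forallP => l; apply/implyP => ul.
  apply/implyP => /eqP vl.
  exact: (at_w u k l).
have inSE u k : inS u -> star u 0 k != 0 -> star v 0 k = 0 -> k \in S.
  by move=> /forallP/(_ k)/implyP h /h/implyP h' e; apply: h'; rewrite e.
have hi k : star (head k) 0 k != 0 by rewrite star_neq0 eqxx.
have hv k : star v 0 k = 0 -> head k != v.
  by move=> vk; apply: contraNneq (hi k) => ->; rewrite vk.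
apply: (inSE (head j)) => //.
rewrite -(@connect_const [set v] _ inS (head i) (head j)).
- exact: (inSP _ i) (hv _ vi) (hi _) vi iS.
- by apply: connect_off; rewrite ?cards1 ?inE ?hv.
move=> a b /and3P[]; rewrite !inE => av bv ab.
have nab : a != b by apply: contraTneq ab => ->; rewrite adj_irr.
move: (ab); rewrite (adj_star nab) => /existsP[k /andP[ak bk]].
have vk : star v 0 k = 0.
  apply/eqP; apply: contraT => vk; move: av bv; have := star2_ends nab ak bk.
  by move: vk; rewrite star_neq0 => /orP[]/eqP <- [] [<- <-]; rewrite eqxx.
apply/idP/idP => /inSE/(_ _ vk) h.
  by apply: (inSP b k); rewrite ?h.
by apply: (inSP a k); rewrite ?h.
Qed.

(** * Isometries preserving the cycle space *)

Section SignedPermutation.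
Variables (A : 'M[R]_#|D|) (sigma : 'S_#|D|) (s : 'I_#|D| -> R).
Hypothesis AE : forall i k, A i k = s i *+ (k == sigma i).
Hypothesis s_norm : forall i, `|s i| = 1.
Hypothesis AZ : (cycle_space R D *m A :=: cycle_space R D)%MS.

Lemma signed_perm_sqr i : s i * s i = 1.
Proof. by rewrite -expr2 -[s i ^+ 2]real_normK ?num_real // s_norm expr1n. Qed.

Lemma signed_perm_neq0 i : s i != 0.
Proof. by rewrite -normr_eq0 s_norm oner_eq0. Qed.

Lemma signed_permE F i : (F *m A) 0 (sigma i) = F 0 i * s i.
Proof.
rewrite mxE (bigD1 i) //= AE eqxx mulr1n big1 ?addr0 // => j ji.
by rewrite AE (inj_eq perm_inj) eq_sym (negbTE ji) mulr0n mulr0.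
Qed.

Lemma signed_perm_trE F i : (F *m A^T) 0 i = F 0 (sigma i) * s i.
Proof.
rewrite mxE (bigD1 (sigma i)) //= mxE AE eqxx mulr1n big1 ?addr0 // => j ji.
by rewrite mxE AE (negbTE ji) mulr0n mulr0.
Qed.

Lemma signed_permK F : F *m A *m A^T = F.
Proof.
apply/rowP => i; rewrite signed_perm_trE signed_permE -mulrA signed_perm_sqr.
exact: mulr1.
Qed.

Lemma signed_permKV F : F *m A^T *m A = F.
Proof.
apply/rowP => k; rewrite -[k](permKV sigma) signed_permE signed_perm_trE.
by rewrite -mulrA signed_perm_sqr mulr1.
Qed.

Lemma signed_perm_mulK : A *m A^T = 1%:M.
Proof. by apply/row_matrixP => i; rewrite !rowE mulmxA signed_permK mulmx1. Qed.

(** The transpose is the inverse of [A]. Its preserving the cycle space is what makes [A] preserve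
    the cut space. *)
Lemma cycle_space_tr : (cycle_space R D *m A^T <= cycle_space R D)%MS.
Proof. by rewrite -(eqmxMr A^T AZ) -mulmxA signed_perm_mulK mulmx1. Qed.

Lemma cut_signed_perm F :
  (F <= cut_space R D)%MS -> (F *m A <= cut_space R D)%MS.
Proof.
move=> FB; apply: submx_trans (submxMr A FB) _.
exact: orthmx_stable cycle_space_tr.
Qed.

Lemma cut_signed_perm_tr F :
  (F <= cut_space R D)%MS -> (F *m A^T <= cut_space R D)%MS.
Proof.
move=> FB; apply: submx_trans (submxMr A^T FB) _.
by apply: orthmx_stable; rewrite trmxK AZ.
Qed.

Lemma star_cut v : (star v <= cut_space R D)%MS.
Proof. by apply/cut_potP; exists (fun u => (u == v)%:R). Qed.

(* If [star v *m A] were the difference of a potential [g] and every vertex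
   had an edge on which it vanishes, the edges inside one level set of [g]
   would separate the image under [sigma] of the edges of [G - v]. *)
Lemma star_image_untouched v :
  exists x, forall i, star x 0 i != 0 -> (star v *m A) 0 i != 0.
Proof.
set F := star v *m A.
have [|] := boolP [exists x, forall i, (star x 0 i != 0) ==> (F 0 i != 0)].
  by case/existsP=> x /forallP h; exists x => i; apply/implyP.
rewrite negb_exists => /forallP touched.
have {}touched x : exists i, star x 0 i != 0 /\ F 0 i = 0.
  have:= touched x; rewrite negb_forall => /existsP[i].
  by rewrite negb_imply negbK => /andP[xi /eqP]; exists i.
have /cut_potP[g Fg] := cut_signed_perm (star_cut v).
rewrite -/F in Fg; have F0P k : F 0 k = 0 <-> g (head k) = g (tail k).
  rewrite Fg mxE; split=> [/eqP|->]; last exact: subrr.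
  by rewrite subr_eq0 => /eqP.
have Fv i : F 0 (sigma i) = 0 <-> star v 0 i = 0.
  rewrite signed_permE; split=> [/eqP|->]; last exact: mul0r.
  by rewrite mulf_eq0 (negbTE (signed_perm_neq0 _)) orbF => /eqP.
have [k vk] := exists_star v.
have gk : g (head (sigma k)) != g (tail (sigma k)).
  by apply: contra vk => /eqP /F0P /Fv ->.
have [i1 [ai1 Fi1]] := touched (head (sigma k)).
have [i2 [bi2 Fi2]] := touched (tail (sigma k)).
have level x i : star x 0 i != 0 -> F 0 i = 0 -> g (tail i) = g x.
  by rewrite star_neq0 => /orP[]/eqP <- /F0P.
(* Where [F] vanishes both ends have the same value of [g], so testing the tail suffices. *)
pose lev i := g (tail i) == g (head (sigma k)).
pose S := [set i | (F 0 (sigma i) == 0) && lev (sigma i)].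
have inS i : (sigma^-1%g i \in S) = (F 0 i == 0) && lev i.
  by rewrite inE permKV.
(* [i2] lies in the level of the tail of [sigma k], so this would identify the two levels, against
   [gk]. *)
suff /andP[_ /eqP e] : (F 0 i2 == 0) && lev i2.
  by case/eqP: gk; rewrite -e; apply: level.
rewrite -inS; apply: (@star_compl_connected v S _ (sigma^-1%g i1)); last first.
- by rewrite inS Fi1 /lev (level _ _ ai1 Fi1) !eqxx.
- by apply/Fv; rewrite permKV.
- by apply/Fv; rewrite permKV.
move=> H HZ Hv; rewrite -[restr S H]signed_permK.
apply: submx_trans cycle_space_tr; apply: submxMr.
apply/cycle_potP => h.
have HAZ : (H *m A <= cycle_space R D)%MS by rewrite -AZ submxMr.
(* The test potential is [h] set to zero outside the level set. An edge where [F] vanishes has both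
   ends inside or both outside; on all other edges [H *m A] is zero. *)
rewrite -[RHS]((cycle_potP _).1 HAZ
  (fun u => h u *+ (g u == g (head (sigma k))))) /dotv.
apply: eq_bigr => i _; rewrite -[i](permKV sigma); set j := (sigma^-1)%g i.
rewrite !signed_permE [restr S H 0 j]mxE [pot h 0 _]mxE [pot _ 0 _]mxE inE.
have [/eqP vj|vj] := boolP (star v 0 j == 0); last first.
  by rewrite Hv // mul0rn !mul0r.
have Fj : F 0 (sigma j) = 0 by apply/Fv.
rewrite Fj eqxx /lev ((F0P _).1 Fj) /=; case: (g _ == _); first by rewrite !mulr1n.
by rewrite !mulr0n subrr !mul0r mulr0.
Qed.

(** [A^T] pulls the star found by [star_image_untouched] back to a cut supported in the star of [v],
    hence to a multiple of it; the factor is nonzero and can be inverted. *)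
Lemma star_image v : exists x (c : R), star v *m A = c *: star x.
Proof.
have [x xv] := star_image_untouched v; exists x.
have /cut_potP[g xg] := cut_signed_perm_tr (star_cut x).
have [i vi|c vc] := @pot_supp_star v g.
  rewrite -xg signed_perm_trE; apply/eqP; rewrite mulf_eq0; apply/orP; left.
  by apply: contraT => /xv; rewrite signed_permE vi mul0r eqxx.
have xE : star x = c *: (star v *m A).
  by rewrite scalemxAl -vc -xg signed_permKV.
have c0 : c != 0.
  have [i xi] := exists_star x; apply: contraNneq xi => c0.
  by rewrite xE c0 scale0r mxE.
by exists c^-1; rewrite xE scalerA mulVf // scale1r.
Qed.

(** Comparing nonzero entries gives factors of absolute value 1, and [star_indep] makes the vertex
    map injective. *)
Lemma star_perm : exists (p : {perm T}) (c : R),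
  `|c| = 1 /\ forall v, star v *m A = c *: star (p v).
Proof.
have [tau /fin_all_exists[c tauE]] := fin_all_exists star_image.
have cn v : `|c v| = 1.
  have [i vi] := exists_star v; have ti : star (tau v) 0 (sigma i) != 0.
    apply: contraNneq vi => ti; have := signed_permE (star v) i.
    rewrite tauE mxE ti mulr0 => /esym/eqP.
    by rewrite mulf_eq0 (negbTE (signed_perm_neq0 _)) orbF.
  have := congr1 Num.norm (signed_permE (star v) i).
  by rewrite tauE mxE !normrM (norm_star ti) (norm_star vi) s_norm !mulr1.
have inj_tau : injective tau.
  move=> v w e; apply/eqP; apply: contraT => vw.
  have : c w *: star v = c v *: star w.
    rewrite -[LHS]signed_permK -[RHS]signed_permK -!scalemxAl !tauE e.
    by rewrite -!scalemxAl !scalerA mulrC.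
  by move/(star_indep vw)/eqP; rewrite -normr_eq0 cn oner_eq0.
pose p := perm inj_tau.
have [v0 _] : exists x : T, x \notin set0.
  by apply: exists_notin; rewrite cards0.
(* Applying [A] to the relation that all stars sum to zero gives a relation with coefficients [c];
   by connectedness a potential with zero differences is constant. *)
have cE v : c v = c v0.
  have: pot (fun u => c (p^-1%g u)) = 0.
    rewrite pot_sum (reindex_inj (@perm_inj _ p)) /=.
    have e : pot (fun=> 1) *m A = 0 by rewrite pot_const mul0mx.
    rewrite -[RHS]e [in RHS]pot_sum mulmx_suml.
    by apply: eq_bigr => u _; rewrite permK scale1r tauE permE.
  by move/(@pot_eq0 _ (p v) (p v0)); rewrite !permK.
by exists p, (c v0); split=> // v; rewrite tauE permE cE.
Qed.

(** The edge [i] lies in the stars of both its ends, so [sigma i] lies in the stars of their images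
    and is the edge between them; the star of the head then fixes the sign. *)
Lemma signed_perm_aut : exists2 p, p \in Aut G &
  exists c : R, A = c *: aut_mx R D p.
Proof.
have [p [c [c1 pE]]] := star_perm.
have c2 : c * c = 1.
  by rewrite -expr2 -[c ^+ 2]real_normK ?num_real // c1 expr1n.
have c0 : c != 0 by rewrite -normr_eq0 c1 oner_eq0.
have star_sigma v i : c * star (p v) 0 (sigma i) = star v 0 i * s i.
  by rewrite -signed_permE pE [RHS]mxE.
have supp v i : (star (p v) 0 (sigma i) != 0) = (star v 0 i != 0).
  have /(congr1 (fun a : R => a == 0)) := star_sigma v i.
  by rewrite !mulf_eq0 (negbTE c0) (negbTE (signed_perm_neq0 _)) orbF /= => ->.
exists p.
  apply/autP => u v; have [->|uv] := eqVneq u v; first by rewrite !adj_irr.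
  rewrite !adj_star ?(inj_eq perm_inj) //; apply/existsP/existsP => -[i].
    by rewrite -[i](permKV sigma) !supp; exists (sigma^-1%g i).
  by exists (sigma i); rewrite !supp.
exists c; apply/row_matrixP => i.
have -> : row i A = s i *: delta_mx 0 (sigma i).
  by apply/rowP => k; rewrite !mxE AE eqxx /= mulr_natr.
rewrite linearZ /= rowK; set k := sigma i.
have ph := star_sigma (head i) i; have pt := star_sigma (tail i) i.
have ht := head_neq_tail i.
have pht : p (head i) != p (tail i) by rewrite (inj_eq perm_inj).
have si : c * star (p (head i)) 0 k = s i.
  by rewrite ph starE eqxx eq_sym (negbTE ht) subr0 mul1r.
have [] := star2_ends pht (_ : star _ 0 k != 0) (_ : star _ 0 k != 0).
- by rewrite supp star_neq0 eqxx.
- by rewrite supp star_neq0 eqxx orbT.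
- move=> [hk tk]; rewrite -hk -tk arc_vec_arc; congr (_ *: _); rewrite -si.
  by rewrite starE hk tk eqxx eq_sym (negbTE pht) subr0 mulr1.
move=> [hk tk]; rewrite -hk -tk arc_vecN arc_vec_arc scalerN -scaleNr.
congr (_ *: _); rewrite -si starE hk tk eqxx eq_sym (negbTE pht).
by rewrite sub0r mulrN1.
Qed.

End SignedPermutation.

Lemma Cyc_aut A :
  Cyc A -> exists2 p, p \in Aut G & exists c : R, A = c *: aut_mx R D p.
Proof.
case=> l1A AZ; have [sigma [s [AE s1]]] := l1_isometry_monomial l1A.
exact: signed_perm_aut AE s1 AZ.
Qed.

End Connected.

(** * Automorphisms as elements of [Cyc] *)

Lemma aut_mx_tr (p : {perm T}) : (aut_mx R D p)^T = aut_mx R D p^-1%g.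
Proof.
apply/matrixP => i k; rewrite !mxE.
have E (a b c d : T) :
    ((a, b) == (p c, p d)) = ((c, d) == (p^-1%g a, p^-1%g b)).
  by rewrite !xpair_eqE ![_ == (p^-1)%g _]eq_sym !(canF_eq (permKV p)).
have arcE j : enum_val j = (tail j, head j) by rewrite -surjective_pairing.
by rewrite !arcE !E; congr (_ - _%:R); rewrite !xpair_eqE andbC.
Qed.

(** The transpose of [aut_mx p] takes the differences of [g] to those of [g] composed with [p], so
    orthogonality to all potential differences persists. *)
Lemma cycle_aut F p : p \in Aut G ->
  (F <= cycle_space R D)%MS -> (F *m aut_mx R D p <= cycle_space R D)%MS.
Proof.
move=> /autP Gp /cycle_potP FZ; apply/cycle_potP => g.
have potE : aut_mx R D p *m (pot g)^T = (pot (fun u => g (p u)))^T.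
  apply/colP => i; rewrite mxE [RHS]mxE [RHS]mxE.
  have Gi : G (p (tail i)) (p (head i)) by rewrite Gp arc_adj.
  have [_ [_ <-]] := arc_vec_delta Gi.
  by apply: eq_bigr => k _; rewrite !mxE.
by rewrite dotvE -mulmxA potE -dotvE FZ.
Qed.

(** Every row of [aut_mx p] has l1-norm 1. Applied to [p] and to its inverse, the inequality yields
    an isometry. *)
Lemma l1norm_aut_le F p : p \in Aut G -> l1norm (F *m aut_mx R D p) <= l1norm F.
Proof.
move=> /autP Gp; rewrite /l1norm.
have row1 i : \sum_k `|aut_mx R D p i k| = 1.
  have Gi : G (p (tail i)) (p (head i)) by rewrite Gp arc_adj.
  rewrite (eq_bigr (fun k => `|arc_vec R D (p (tail i)) (p (head i)) 0 k|));
    last by move=> k _; rewrite mxE.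
  have [j [e _]] := arc_vec_delta Gi.
  rewrite (bigD1 j) //= big1 ?addr0 => [|k kj].
    by case: e => ->; rewrite !mxE !eqxx ?normrN normr1.
  by case: e => ->; rewrite !mxE (negbTE kj) andbF ?oppr0 normr0.
apply: (@le_trans _ _ (\sum_k \sum_i `|F 0 i| * `|aut_mx R D p i k|)).
  apply: ler_sum => k _; rewrite mxE (le_trans (ler_norm_sum _ _ _)) //.
  by apply: ler_sum => i _; rewrite normrM.
rewrite exchange_big; apply: ler_sum => i _ /=.
by rewrite -mulr_sumr row1 mulr1.
Qed.

Lemma aut_mxK p : p \in Aut G -> aut_mx R D p *m aut_mx R D p^-1%g = 1%:M.
Proof.
move=> Ap; rewrite -[RHS](repr_mx1 (aut_repr R D)) -(mulgV p).
by rewrite (repr_mxM _ Ap) ?groupV.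
Qed.

Lemma aut_Cyc p : p \in Aut G -> Cyc (aut_mx R D p).
Proof.
move=> Ap; have Ap' : p^-1%g \in Aut G by rewrite groupV.
split=> [F|]; last first.
  have sub q : q \in Aut G ->
      (cycle_space R D *m aut_mx R D q <= cycle_space R D)%MS.
    move=> Aq; apply/row_subP => i; rewrite row_mul.
    by apply: cycle_aut; rewrite ?row_sub.
  apply/eqmxP; rewrite sub //=.
  rewrite -{1}[cycle_space R D]mulmx1 -(aut_mxK Ap') invgK mulmxA.
  by rewrite submxMr // sub.
apply/le_anti; rewrite l1norm_aut_le //=.
by rewrite -{1}[F]mulmx1 -(aut_mxK Ap) mulmxA l1norm_aut_le.
Qed.

End Potentials.

Theorem corollary6 (R : realType) (T : finType) (G : sgraph T)
    (G3 : kconnected 3 G) (D : orientation G) :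
  (exists! P : 'M[R]_#|D|,
     projection_onto (cycle_space R D) P /\ Cyc_invariant P)
  <->
  ~ (exists (U V : 'M[R]_#|D|)
            (modU : mxmodule (aut_repr R D) U)
            (modV : mxmodule (aut_repr R D) V),
       [/\ U != 0, V != 0,
           (U <= cycle_space R D)%MS, (V <= cut_space R D)%MS
         & mx_rsim (submod_repr modU) (submod_repr modV)]).
Proof.
(* By [Cyc_aut] each element of [Cyc] is a multiple of some [aut_mx p], and the factor does not
   affect commutation. *)
have invE (P : 'M[R]_#|D|) : Cyc_invariant P <-> centgmx (aut_repr R D) P.
  split=> [cycP | /centgmxP autP A /(Cyc_aut G3)[p Ap [c ->]]].
    by apply/centgmxP => p Ap; apply/cycP/aut_Cyc.
  by rewrite -scalemxAr -scalemxAl (autP p Ap).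
have rGT p : p \in Aut G -> (aut_repr R D p)^T = aut_repr R D p^-1%g.
  by move=> _; apply: aut_mx_tr.
have modZ : mxmodule (aut_repr R D) (cycle_space R D).
  by apply/mxmoduleP => p /(aut_Cyc R D)[_ ->].
rewrite -(unique_equivariant_projection rGT modZ).
split=> -[P [[projP invP] uniqP]]; exists P; split=> [|P' [projP' invP']].
- by split=> //; apply/invE.
- by apply: uniqP; split=> //; apply/invE.
- by split=> //; apply/invE.
- by apply: uniqP; split=> //; apply/invE.
Qed.
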